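(* Let $X$ be a set of alternatives, let $\Pi$ be a Pos-compatible and consistent permutation process over $X$, let $f$ be a scoring rule with an associated decreasing weight vector, and let $A\subseteq X$ be a nonempty finite set. Then $f(\Pi(A))=\{a\in A: a\rhd^{pos}_{\Pi(A)}b\ \text{for all } b\in A\}$.
   Context: For a nonempty finite $A\subseteq X$, $S_A$ is the set of bijections $\sigma:A\to\{1,\dots,|A|\}$ (rankings); $\sigma(a)$ is the position of $a$. An anonymous preference profile over $A$ is a probability distribution $\pi$ on $S_A$. A permutation process $\Pi$ over $X$ assigns to each nonempty finite $A\subseteq X$ a probability distribution $\Pi(A)$ on $S_A$ (regarded as a profile over $A$). It is consistent if for all nonempty finite $B\subseteq A\subseteq X$, $\Pi(B)(\sigma')=\sum_{\sigma\in S_A:\sigma|_B=\sigma'}\Pi(A)(\sigma)$ for $\sigma'\in S_B$, where $\sigma|_B\in S_B$ is the ranking of $B$ induced by $\sigma$. Pos-dominance: for a profile $\pi$ over $A$ let $s_j(a)=\sum_{\sigma:\sigma(a)\le j}\pi(\sigma)$; $a\rhd^{pos}_\pi b$ iff $s_j(a)\ge s_j(b)$ for all $j\in\{1,\dots,|A|\}$. For $a,b\in X$, $a\rhd^{pos}_\Pi b$ iff $a\rhd^{pos}_{\Pi(A)}b$ for every finite $A\subseteq X$ containing $a,b$. $\Pi$ is Pos-compatible if for every $A\subseteq X$ the restriction of $\rhd^{pos}_\Pi$ to $A$ is a total preorder (transitive and complete). A scoring rule has, for each size $k$ of the set of alternatives, a weight vector $(\alpha_1,\dots,\alpha_k)$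 with $\alpha_i\ge\alpha_{i+1}$ for all $i<k$; for a profile $\pi$ over $A$ with $|A|=k$ it selects the alternatives $a\in A$ maximizing $\sum_{\sigma\in S_A}\pi(\sigma)\,\alpha_{\sigma(a)}$. The weight vector is decreasing if $\alpha_i>\alpha_{i+1}$ for all $i<k$. *)

(* Defs.v *)
From HB Require Import structures.
From mathcomp Require Import all_boot all_order all_algebra finmap.
From mathcomp Require Import classical_sets reals.

Set Implicit Arguments.
Unset Strict Implicit.
Unset Printing Implicit Defensive.
Import Order.TTheory GRing.Theory Num.Theory.
Local Open Scope fset_scope.
Local Open Scope ring_scope.

Record nefset (X : choiceType) := NEFset {
  nefset_val :> {fset X};
  nefset_neq0 : nefset_val != fset0
}.

Section Rankings.
Context {X : choiceType}.
Implicit Types A B : {fset X}.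

(* Positions are counted from 0: the position usually called j (1 <= j <= |A|)
   is the ordinal j - 1 of 'I_#|`A|.  The value 0 is the best position. *)
Record ranking (A : {fset X}) := Ranking {
  rank_fun :> {ffun A -> 'I_#|` A|};
  rank_bij : injectiveb rank_fun && [forall i, i \in codom rank_fun]
}.
HB.instance Definition _ A := [isSub for @rank_fun A].
HB.instance Definition _ A := [Finite of ranking A by <:].

Section Restriction.
Variables (A B : {fset X}) (sBA : B `<=` A) (s : ranking A).

(* The elements of B placed by s strictly before b. *)
Definition rank_before (b : B) : {set B} :=
  [set c | s (fincl sBA c) < s (fincl sBA b)]%N.

Fact restr_rank_subproof (b : B) : (#|rank_before b| < #|` B|)%N.
Proof.
rewrite cardfE; apply: (@leq_trans #|[set: B]|); last by rewrite cardsT.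
apply: proper_card; apply/properP; split; first exact: finset.subsetT.
by exists b; rewrite ?inE ?ltnn.
Qed.

Definition restr_fun : {ffun B -> 'I_#|` B|} :=
  [ffun b => Ordinal (restr_rank_subproof b)].

Fact rank_before_lt (b c : B) :
  (s (fincl sBA b) < s (fincl sBA c))%N -> (restr_fun b < restr_fun c)%N.
Proof.
move=> bc; rewrite !ffunE /=; apply: proper_card; apply/properP; split.
  by apply/fintype.subsetP => d; rewrite !inE => /ltn_trans; apply.
by exists b; rewrite !inE ?ltnn.
Qed.

Fact restr_bij : injectiveb restr_fun && [forall i, i \in codom restr_fun].
Proof.
have inj : injective restr_fun.
  move=> b c e; have /andP[/injectiveP sinj _] := rank_bij s.
  have [/rank_before_lt|/rank_before_lt|/val_inj/sinj/(congr1 val) /= h] :=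
    ltngtP (s (fincl sBA b)) (s (fincl sBA c)); rewrite ?e ?ltnn //.
  exact: val_inj.
apply/andP; split; first exact/injectiveP.
apply/forallP => i; apply: (inj_card_onto inj).
by rewrite card_ord cardfE.
Qed.

Definition restr : ranking B := Ranking restr_bij.

Lemma restr_lt (b c : B) :
  (restr b < restr c)%N = (s (fincl sBA b) < s (fincl sBA c))%N.
Proof.
apply/idP/idP => [|/rank_before_lt//]; apply: contraLR; rewrite -!leqNgt.
rewrite leq_eqVlt => /orP[/eqP|/rank_before_lt/ltnW//].
have /andP[/injectiveP sinj _] := rank_bij s.
by move=> /val_inj/sinj/(congr1 val) /= /val_inj ->.
Qed.

End Restriction.
End Rankings.

Section PositionProcesses.
Context {X : choiceType} {R : realType}.

Record profile (A : {fset X}) := Profile {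
  profile_fun :> ranking A -> R;
  profile_ge0 : forall s, 0 <= profile_fun s;
  profile_sum1 : \sum_(s : ranking A) profile_fun s = 1
}.

Definition permutation_process := forall A : nefset X, profile A.

Definition consistent (Pi : permutation_process) : Prop :=
  forall (A B : nefset X) (sBA : B `<=` A) (s' : ranking B),
    Pi B s' = \sum_(s : ranking A | restr sBA s == s') Pi A s.

Definition top_share (A : {fset X}) (p : profile A) (j : nat) (a : A) : R :=
  \sum_(s : ranking A | ((s a).+1 <= j)%N) p s.

Definition pos_dom (A : {fset X}) (p : profile A) (a b : A) : bool :=
  [forall j : 'I_#|` A|, top_share p j.+1 b <= top_share p j.+1 a].

Definition pos_dom_process (Pi : permutation_process) (a b : X) : Prop :=
  forall (A : nefset X) (aA : a \in nefset_val A) (bA : b \in nefset_val A),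
    pos_dom (Pi A) [` aA] [` bA].

Definition total_preorder_on (A : set X) (r : X -> X -> Prop) : Prop :=
  (forall a b c, A a -> A b -> A c -> r a b -> r b c -> r a c) /\
  (forall a b, A a -> A b -> r a b \/ r b a).

Definition pos_compatible (Pi : permutation_process) : Prop :=
  forall A : set X, total_preorder_on A (pos_dom_process Pi).

End PositionProcesses.

Section ScoringRules.
Context {R : realType}.

Record scoring_rule := ScoringRule {
  weight : forall k : nat, 'I_k -> R;
  weight_nonincr : forall (k : nat) (i j : 'I_k),
    j = i.+1 :> nat -> weight j <= weight i
}.

Definition decreasing_weights (f : scoring_rule) : Prop :=
  forall (k : nat) (i j : 'I_k), j = i.+1 :> nat -> weight f j < weight f i.

Context {X : choiceType}.

Definition score (f : scoring_rule) (A : {fset X}) (p : @profile X R A) (a : A)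
  : R := \sum_(s : ranking A) p s * weight f (s a).

Definition selected (f : scoring_rule) (A : {fset X}) (p : @profile X R A)
  : {set A} := [set a | [forall b, score f p b <= score f p a]].

End ScoringRules.

Arguments profile {X} R A.
Arguments permutation_process X R : clear implicits.
Arguments scoring_rule R : clear implicits.

(* Main.v *)
(** Abel summation writes the score of an alternative as
    [\sum_j (alpha_j - alpha_(j+1)) * s_j], where the last cumulative share is
    1 for every alternative.  So Pos-dominance implies a score at least as
    large, and when the weights decrease strictly two Pos-comparable
    alternatives of equal score have the same cumulative shares.  As
    Pos-compatibility makes any two alternatives of A Pos-comparable, the score
    maximizers are exactly the Pos-maximal alternatives. *)

Require Import Defs.
From mathcomp Require Import all_boot all_order all_algebra finmap.
From mathcomp Require Import classical_sets reals.

Set Implicit Arguments.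
Unset Strict Implicit.
Unset Printing Implicit Defensive.

Import Order.TTheory GRing.Theory Num.Theory.
Local Open Scope ring_scope.

Section WeightGap.
Variables (R : realType) (f : scoring_rule R).

(* Extending the weights by 0 makes the last gap equal to the last weight. *)
Definition weight0 (k n : nat) : R := oapp (@weight R f k) 0 (insub n).

Definition weight_gap (k n : nat) : R := weight0 k n - weight0 k n.+1.

Lemma weight0_ord (k : nat) (i : 'I_k) : weight0 k i = weight f i.
Proof. by rewrite /weight0 valK. Qed.

Lemma weight_sum_gap (k : nat) (i : 'I_k) :
  weight f i = \sum_(j < k | (i <= j)%N) weight_gap k j.
Proof.
transitivity (\sum_(i <= j < k) weight_gap k j).
  rewrite (telescope_sumr_eq (fun n => - weight0 k n)); last 2 first.
  - exact: ltnW.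
  - by move=> j _; rewrite opprK addrC.
  (* Index [k] lies outside ['I_k], so the upper end of the telescope is the default 0. *)
  by rewrite opprK weight0_ord /weight0 insubF ?ltnn // oppr0 add0r.
rewrite (big_nat_widenl _ 0) // big_mkord.
by apply: eq_bigl => j.
Qed.

Lemma weight_gap_gt0 (k n : nat) :
  decreasing_weights f -> (n.+1 < k)%N -> 0 < weight_gap k n.
Proof.
move=> fdec nk; rewrite subr_gt0.
have := fdec k (Ordinal (ltnW nk)) (Ordinal nk) erefl.
by rewrite -!weight0_ord.
Qed.

End WeightGap.

Section Score.
Variables (R : realType) (X : choiceType) (f : scoring_rule R).
Variables (A : {fset X}) (p : profile R A).

Lemma score_top_share (a : A) :
  score f p a =
  \sum_(j < #|` A|) weight_gap f #|` A| j * top_share p j.+1 a.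
Proof.
rewrite /score; under eq_bigr do rewrite weight_sum_gap mulr_sumr.
(* Gap [j] collects the rankings with [s a <= j], positions counted from 0: hence [j.+1] in
   [top_share]. *)
rewrite (exchange_big_dep predT) //=; apply: eq_bigr => j _.
by rewrite mulr_sumr; apply: eq_bigr => s _; rewrite mulrC.
Qed.

Lemma top_share_card (a : A) : top_share p #|` A| a = 1.
Proof.
by rewrite -(profile_sum1 p); apply: eq_bigl => s; rewrite ltn_ord.
Qed.

Hypothesis f_decreasing : decreasing_weights f.

(** The last gap is the last weight, of arbitrary sign, but there both shares are 1. *)
Lemma pos_dom_gap_ge0 (a b : A) (j : 'I_#|` A|) : pos_dom p a b ->
  0 <= weight_gap f #|` A| j * (top_share p j.+1 a - top_share p j.+1 b).
Proof.
move=> /forallP ab.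
have [jk|kj] := ltnP j.+1 #|` A|.
  by apply: mulr_ge0; [exact/ltW/weight_gap_gt0 | rewrite subr_ge0 ab].
have -> : j.+1 = #|` A| by apply/eqP; rewrite eqn_leq kj ltn_ord.
by rewrite !top_share_card subrr mulr0.
Qed.

Lemma score_sub (a b : A) : score f p a - score f p b =
  \sum_(j < #|` A|)
    weight_gap f #|` A| j * (top_share p j.+1 a - top_share p j.+1 b).
Proof.
by rewrite !score_top_share -sumrB; apply: eq_bigr => j _; rewrite mulrBr.
Qed.

Lemma pos_dom_score (a b : A) : pos_dom p a b -> score f p b <= score f p a.
Proof.
move=> ab; rewrite -subr_ge0 score_sub.
by apply: sumr_ge0 => j _; exact: pos_dom_gap_ge0.
Qed.

Lemma pos_dom_score_sym (a b : A) :
  pos_dom p b a -> score f p b <= score f p a -> pos_dom p a b.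
Proof.
move=> ba le_ba; apply/forallP => j.
have [jk|kj] := ltnP j.+1 #|` A|; last first.
  have -> : j.+1 = #|` A| by apply/eqP; rewrite eqn_leq kj ltn_ord.
  by rewrite !top_share_card.
have /eqP : score f p b - score f p a = 0.
  by apply/eqP; rewrite subr_eq0 eq_le le_ba pos_dom_score.
(* Nonnegative terms with sum 0 all vanish, and a positive gap can be cancelled. *)
rewrite score_sub psumr_eq0 => [/allP/(_ j)|i _]; last exact: pos_dom_gap_ge0.
rewrite mem_index_enum => /(_ isT) /=.
by rewrite mulf_eq0 (gt_eqF (weight_gap_gt0 f_decreasing jk)) subr_eq0 => /eqP ->.
Qed.

End Score.

Theorem theorem3 (R : realType) (X : choiceType) (Pi : permutation_process X R)
    (Pi_compatible : pos_compatible Pi) (Pi_consistent : consistent Pi)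
    (f : scoring_rule R) (f_decreasing : decreasing_weights f)
    (A : nefset X) :
  selected f (Pi A) = [set a : A | [forall b : A, pos_dom (Pi A) a b]]%SET.
Proof.
apply/setP => a; rewrite !inE.
apply/forallP/forallP => sel b; last exact: pos_dom_score.
have [_ /(_ (val a) (val b) I I)] := Pi_compatible setT.
case: a b sel => [a aA] [b bA] sel [] /(_ A) dom; first exact: dom.
(* If instead [b] dominates [a], maximality of the score of [a] reverses the dominance. *)
exact: pos_dom_score_sym (dom bA aA) (sel _).
Qed.
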